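(* Let $0\le m<n$ be integers. For any injective map $s:\{0,\ldots,m\}\to\{0,\ldots,n\}$, the row vector $D^m:=B^mA$ with $A:=E(s,:)^{-1}$ is an affine basis of $\mathcal{P}_m$ dual to $\Lambda^n(s)$; that is, $D^m=[D_0^m,\ldots,D_m^m]$ is a basis of $\mathcal{P}_m$, $\lambda^n_{s(i)}D^m_j=\delta_{ij}$ for $0\le i,j\le m$, and $\sum_{i=0}^m D_i^m(t)=1$ for all $t$.
   Context: $\mathcal{P}_n$ is the space of real polynomials of degree at most $n$. The Bernstein basis is the row vector $B^n=[B_0^n,\ldots,B_n^n]$ with $B_i^n(t)=\binom{n}{i}(1-t)^{n-i}t^i$. The dual Bernstein functionals $\Lambda^n=[\lambda_0^n,\ldots,\lambda_n^n]$ are $\lambda_k^n f=\sum_{j=0}^k \frac{\binom{k}{j}}{\binom{n}{j}}\frac{1}{j!}f^{(j)}(0)$; they satisfy $\lambda_k^nB_i^n=\delta_{ki}$. The degree elevation matrix $E$ is the $(n+1)\times(m+1)$ matrix, with rows indexed by $0\le i\le n$ and columns by $0\le j\le m$, with entries $E(i,j)=\binom{n-i}{m-j}\binom{i}{j}/\binom{n}{m}$ (zero if $i<j$ or $n-i<m-j$); it satisfies $B^m=B^nE$. $\Lambda^n(s)=[\lambda^n_{s(0)},\ldots,\lambda^n_{s(m)}]$ and $E(s,:)$ is the $(m+1)\times(m+1)$ matrix with entries $E(s(i),j)$ (it is invertible for every injective $s$). *)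

(* Defs.v *)
From HB Require Import structures.
From mathcomp Require Import all_boot all_order all_algebra.

Set Implicit Arguments.
Unset Strict Implicit.
Unset Printing Implicit Defensive.

Import Order.TTheory GRing.Theory Num.Theory.
Local Open Scope ring_scope.

Definition bernstein (R : realFieldType) (n i : nat) : {poly R} :=
  'C(n, i)%:R *: ((1 - 'X) ^+ (n - i) * 'X^i).

Definition bernstein_row (R : realFieldType) (n : nat) :
    'rV[{poly R}]_n.+1 :=
  \row_(i < n.+1) bernstein R n i.

Definition dual_bernstein (R : realFieldType) (n k : nat) (f : {poly R}) : R :=
  \sum_(j < k.+1) 'C(k, j)%:R / 'C(n, j)%:R * (j`!%:R)^-1 * (f^`(j)).[0].

(* The binomials vanish when i < j or n - i < m - j, and the truncated
   subtractions are exact on the index ranges i <= n, j <= m. *)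
Definition elevation (R : realFieldType) (m n : nat) : 'M[R]_(n.+1, m.+1) :=
  \matrix_(i < n.+1, j < m.+1)
    ('C(n - i, m - j)%:R * 'C(i, j)%:R / 'C(n, m)%:R).

(* {poly_(m.+1) R} is the space of polynomials of size at most m + 1, that is
   of degree at most m; its elements coerce to {poly R}. *)
Definition basis_of_degree_le (R : realFieldType) (m k : nat)
    (D : 'rV[{poly R}]_k) : Prop :=
  exists2 b : k.-tuple {poly_(m.+1) R},
    forall j : 'I_k, tnth b j = D 0 j :> {poly R}
    & basis_of {: {poly_(m.+1) R}} b.

(* Main.v *)
Require Import Defs.
From HB Require Import structures.
From mathcomp Require Import all_boot all_order all_algebra.

Set Implicit Arguments.
Unset Strict Implicit.
Unset Printing Implicit Defensive.

Import Order.TTheory GRing.Theory Num.Theory.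
Local Open Scope ring_scope.

(* Pass to the monomial basis.  Write [M(i,l) = C(i,l) / C(n,l)] for the value
    of the [i]-th functional on [t^l], and [T(j,l) = C(j,l) / C(m,l)] for the
    coordinates of [t^l] in the Bernstein basis of degree [m], so that
    [B^m T = (1, t, ..., t^m)].  Vandermonde's convolution gives [E T = M].
    Since [C(i,l)] is a polynomial of degree [l] in [i], the rows of [M]
    selected by an injective [s] form a Vandermonde matrix times an invertible
    triangular one.  Hence [E(s,:)] is invertible and
    [D^m = (1, t, ..., t^m) M(s,:)^-1], from which the basis and duality claims
    are immediate; [D^m] sums to [1] because the column [l = 0] of [M] is
    constantly [1]. *)

(** Trinomial revision: multiplied by l! (j - l)! (a - j)!, both sides become a!. For [j > a] both
    vanish. *)
Lemma mul_bin_bin (a j l : nat) : (l <= j)%N ->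
  ('C(a, j) * 'C(j, l) = 'C(a, l) * 'C(a - l, j - l))%N.
Proof.
move=> le_lj; have [le_ja|lt_aj] := leqP j a; last first.
  rewrite bin_small // mul0n; have [le_la|lt_al] := leqP l a.
    by rewrite [in RHS]mulnC bin_small // ltn_sub2r // (leq_ltn_trans le_la).
  by rewrite [in RHS]bin_small.
have le_la := leq_trans le_lj le_ja.
have fact_n0 : (0 < l`! * (j - l)`! * (a - j)`!)%N by rewrite !muln_gt0 !fact_gt0.
apply/eqP; rewrite -(eqn_pmul2r fact_n0); apply/eqP.
have -> : ('C(a, j) * 'C(j, l) * (l`! * (j - l)`! * (a - j)`!) =
           'C(a, j) * (('C(j, l) * (l`! * (j - l)`!)) * (a - j)`!))%N.
  by rewrite !mulnA.
rewrite bin_fact // bin_fact //.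
have -> : ('C(a, l) * 'C(a - l, j - l) * (l`! * (j - l)`! * (a - j)`!) =
    'C(a, l) * (l`! * ('C(a - l, j - l) * ((j - l)`! * (a - j)`!))))%N.
  by rewrite -!mulnA; congr (_ * _)%N; rewrite mulnCA.
have -> : (a - j = (a - l) - (j - l))%N by rewrite subnBA // subnK.
by rewrite bin_fact ?leq_sub2r // bin_fact.
Qed.

(** The terms with [j < l] vanish; trinomial revision applies to the others. [F] is
    polynomial-valued for the binomial theorem and scalar-valued for Vandermonde's convolution. *)
Lemma sum_mul_bin_bin (V : nmodType) (a m l : nat) (F : nat -> V) :
  (l <= m)%N ->
  \sum_(j < m.+1) F j *+ ('C(a, j) * 'C(j, l)) =
  (\sum_(k < (m - l).+1) F (l + k)%N *+ 'C(a - l, k)) *+ 'C(a, l).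
Proof.
move=> le_lm; rewrite -(big_mkord xpredT (fun j => F j *+ ('C(a, j) * 'C(j, l)))).
rewrite (@big_cat_nat _ _ _ l) //=; last exact: leq_trans le_lm _.
rewrite big_nat big1 ?add0r; last first.
  by move=> j /andP[_ lt_jl]; rewrite (bin_small lt_jl) muln0 mulr0n.
rewrite -{1}[l]add0n big_addn big_mkord subSn // -sumrMnl.
apply: eq_bigr => k _.
by rewrite mul_bin_bin ?leq_addl // addnK -mulrnA mulnC addnC.
Qed.

Lemma natf_bin_neq0 (R : realFieldType) (n k : nat) :
  (k <= n)%N -> 'C(n, k)%:R != 0 :> R.
Proof. by move=> le_kn; rewrite pnatr_eq0 -lt0n bin_gt0. Qed.

Definition monomial_row (R : realFieldType) (m : nat) : 'rV[{poly R}]_m.+1 :=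
  \row_(l < m.+1) 'X^l.

Definition bernstein_coord (R : realFieldType) (m : nat) : 'M[R]_m.+1 :=
  \matrix_(j, l) ('C(j, l)%:R / 'C(m, l)%:R).

Definition dual_monomial (R : realFieldType) (m n : nat) : 'M[R]_(n.+1, m.+1) :=
  \matrix_(i, l) ('C(i, l)%:R / 'C(n, l)%:R).

(** Once ['C(m, l)] is factored out, what remains is ['X^l] times the binomial expansion of (1 - X)
    + X to the power [m - l]. *)
Lemma bernstein_row_coord (R : realFieldType) (m : nat) :
  bernstein_row R m *m map_mx polyC (bernstein_coord R m) = monomial_row R m.
Proof.
apply/rowP => l; rewrite !mxE; have le_lm : (l <= m)%N by rewrite -ltnS.
pose F j : {poly R} := (1 - 'X) ^+ (m - j) * 'X^j.
transitivity ((\sum_(j < m.+1) F j *+ ('C(m, j) * 'C(j, l)))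
              * ('C(m, l)%:R^-1)%:P).
  rewrite mulr_suml; apply: eq_bigr => j _.
  by rewrite !mxE /bernstein polyCM mulrA -/(F j) polyC_natr mulr_natr
             scaler_nat -mulrnA.
have binom : \sum_(k < (m - l).+1) F (l + k)%N *+ 'C(m - l, k) = 'X^l.
  transitivity ('X^l * (1 - 'X + 'X) ^+ (m - l) : {poly R}); last first.
    by rewrite subrK expr1n mulr1.
  rewrite exprDn mulr_sumr; apply: eq_bigr => k _.
  by rewrite mulrnAr /F exprD mulrCA subnDA.
rewrite sum_mul_bin_bin // binom -['X^l *+ _]mulr_natr -polyC_natr -mulrA -polyCM divff.
  by rewrite mulr1.
exact: natf_bin_neq0.
Qed.

Lemma elevation_coord (R : realFieldType) (m n : nat) : (m <= n)%N ->
  elevation R m n *m bernstein_coord R m = dual_monomial R m n.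
Proof.
move=> le_mn; apply/matrixP => i l; rewrite !mxE.
have le_lm : (l <= m)%N by rewrite -ltnS.
have le_in : (i <= n)%N by rewrite -ltnS.
have le_ln := leq_trans le_lm le_mn.
transitivity ((\sum_(j < m.+1) 'C(n - i, m - j)%:R *+ ('C(i, j) * 'C(j, l)))
              / 'C(n, m)%:R / 'C(m, l)%:R : R).
  rewrite !mulr_suml; apply: eq_bigr => j _.
  by rewrite !mxE mulrA -[in RHS]mulr_natr natrM !mulrA (mulrAC _ _ 'C(j, l)%:R).
rewrite (sum_mul_bin_bin i (fun j => 'C(n - i, m - j)%:R)) //.
(* Splitting [n - l] as [(i - l) + (n - i)] for Vandermonde's convolution requires [l <= i]. *)
have [lt_il|le_li] := ltnP i l; first by rewrite bin_small // mulr0n !mul0r.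
have -> : \sum_(k < (m - l).+1) 'C(n - i, m - (l + k))%:R *+ 'C(i - l, k)
          = 'C(n - l, m - l)%:R :> R.
  have -> : (n - l = (i - l) + (n - i))%N by rewrite addnC addnBA // subnK.
  rewrite -binomial.Vandermonde natr_sum; apply: eq_bigr => k _.
  by rewrite natrM -mulr_natl subnDA.
have := congr1 (fun k => k%:R : R) (mul_bin_bin n le_lm); rewrite !natrM => eqC.
rewrite -[_ *+ 'C(i, l)]mulr_natl -!mulrA; congr (_ * _).
rewrite -invfM eqC invfM mulrCA divff ?mulr1 //.
by rewrite natf_bin_neq0 // leq_sub2r.
Qed.

Lemma horner_falling_prod (R : realFieldType) (l i : nat) :
  (\prod_(k < l) ('X - (k%:R)%:P)).[i%:R] = (i ^_ l)%:R :> R.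
Proof.
elim: l => [|l IHl]; first by rewrite big_ord0 hornerE.
rewrite big_ord_recr hornerM IHl /= hornerXsubC ffactnSr natrM.
(* The truncated [i - l] differs from the difference in [R] only when [i < l], where [i ^_ l] is
   already 0. *)
have [le_li|lt_il] := leqP l i; first by rewrite natrB.
by rewrite ffact_small // !mul0r.
Qed.

Lemma dual_monomial_unit (R : realFieldType) (m n : nat)
    (s : 'I_m.+1 -> 'I_n.+1) : (m <= n)%N -> injective s ->
  rowsub s (dual_monomial R m n) \in unitmx.
Proof.
move=> le_mn s_inj.
pose P l : {poly R} := \prod_(k < l) ('X - (k%:R)%:P).
have sizeP l : size (P l) = l.+1.
  by rewrite size_prod_XsubC /index_enum -enumT size_enum_ord.
(* Since ['C(i, l)] is [i ^_ l] divided by l!, the entry in column [l] is [c l] times the value of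
   [P l] at the node [s i]. *)
pose c l : R := (l`!)%:R^-1 / 'C(n, l)%:R.
pose C : 'M[R]_m.+1 := \matrix_(l, k) (c l * (P l)`_k).
pose x : 'rV[R]_m.+1 := \row_i (s i)%:R.
have -> : rowsub s (dual_monomial R m n) = (C *m Vandermonde m.+1 x)^T.
  apply/matrixP => i l; rewrite !mxE.
  transitivity (c l * (P l).[(s i)%:R]).
    rewrite horner_falling_prod -bin_ffact mulnC natrM /c mulrACA.
    by rewrite mulVf ?mul1r 1?mulrC // pnatr_eq0 -lt0n fact_gt0.
  rewrite (@horner_coef_wide _ m.+1); last by rewrite sizeP.
  by rewrite mulr_sumr; apply: eq_bigr => k _; rewrite !mxE mulrA.
rewrite unitmx_tr unitmx_mul !unitmxE; apply/andP; split.
  rewrite det_trig; last first.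
    apply/is_trig_mxP => l k lt_lk.
    by rewrite !mxE nth_default ?mulr0 // sizeP.
  (* [P l] is monic, so the diagonal entry is [c l], nonzero because [l <= m <= n]. *)
  rewrite unitfE; apply/prodf_neq0 => l _; rewrite mxE.
  have -> : (P l)`_l = 1.
    have := lead_coef_prod_XsubC (index_enum 'I_l) xpredT
              (fun k : 'I_l => k%:R : R).
    by rewrite lead_coefE sizeP.
  rewrite mulr1 mulf_neq0 ?invr_neq0 ?pnatr_eq0 -?lt0n ?fact_gt0 // bin_gt0.
  by rewrite (leq_trans _ le_mn) // -ltnS.
rewrite det_Vandermonde unitfE; apply/prodf_neq0 => i _.
apply/prodf_neq0 => j lt_ij; rewrite !mxE subr_eq0 eqr_nat.
by apply: contraTneq lt_ij => /ord_inj/s_inj ->; rewrite ltnn.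
Qed.

Lemma sum_ord_support (V : nmodType) (a b : nat) (F : nat -> V) :
    (forall i, (a <= i)%N -> F i = 0) -> (forall i, (b <= i)%N -> F i = 0) ->
  \sum_(i < a) F i = \sum_(i < b) F i.
Proof.
wlog le_ab : a b / (a <= b)%N => [IH Fa Fb | Fa _].
  by have [le_ab|/ltnW le_ba] := leqP a b; [|symmetry]; apply: IH.
rewrite (big_ord_widen b F le_ab) big_mkcond; apply: eq_bigr => i _ /=.
by case: ltnP => // /Fa.
Qed.

(** The [l]-th derivative at 0 is l! times the coefficient. The cutoff [k] can become [m]: terms
    past [k] vanish by the binomial, terms past [m] by the degree. *)
Lemma dual_bernstein_coef (R : realFieldType) (m n k : nat) (p : {poly R}) :
  (size p <= m.+1)%N ->
  dual_bernstein n k p = \sum_(l < m.+1) 'C(k, l)%:R / 'C(n, l)%:R * p`_l.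
Proof.
move=> size_p; rewrite /dual_bernstein.
transitivity (\sum_(l < k.+1) 'C(k, l)%:R / 'C(n, l)%:R * p`_l).
  apply: eq_bigr => l _; rewrite horner_coef0 coef_derivn addn0 ffactnn.
  rewrite -mulrA -[_`_l *+ _]mulr_natl mulKf //.
  by rewrite pnatr_eq0 -lt0n fact_gt0.
apply: (sum_ord_support (F := fun l => 'C(k, l)%:R / 'C(n, l)%:R * p`_l)) => l lt_l.
  by rewrite bin_small // !mul0r.
by rewrite nth_default ?mulr0 // (leq_trans size_p).
Qed.

Lemma monomial_rowE (R : realFieldType) (m k : nat) (N : 'M[R]_(m.+1, k)) j :
  (monomial_row R m *m map_mx polyC N) 0 j = \poly_(l < m.+1) N (inord l) j.
Proof.
rewrite mxE poly_def; apply: eq_bigr => l _.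
by rewrite !mxE inord_val mulrC mul_polyC.
Qed.

(** The columns of [N] are the coefficient vectors, so a vanishing combination [u] gives [N u = 0],
    hence [u = 0]; the dimension [m.+1] does the rest. *)
Lemma monomial_row_basis (R : realFieldType) (m : nat) (N : 'M[R]_m.+1) :
  N \in unitmx -> basis_of_degree_le m (monomial_row R m *m map_mx polyC N).
Proof.
move=> N_unit; set D := _ *m _.
have coefD l j : (D 0 j)`_(val l) = N l j.
  by rewrite monomial_rowE coef_poly ltn_ord inord_val.
have sizeD j : (size (D 0%R j) <= m.+1)%N by rewrite monomial_rowE size_poly.
pose b := [tuple NPoly (sizeD j) | j < m.+1].
exists b => [j|]; first by rewrite tnth_mktuple.
suff b_free : free b by rewrite basisEfree b_free subvf dim_polyn size_tuple /=.
apply/(@freeP _ _ m.+1 b) => u sum_ub0 i.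
suff Nu0 : N *m (\col_j u j) = 0.
  by have := congr1 (fun v : 'cV_m.+1 => (invmx N *m v) i 0) Nu0;
     rewrite mulKmx // mulmx0 !mxE.
apply/colP => l; rewrite !mxE.
have := congr1 (fun p : {poly_(m.+1) R} => (p : {poly R})`_l) sum_ub0.
rewrite coef0 => u0; rewrite -[RHS]u0 raddf_sum /= coef_sum; apply: eq_bigr => j _.
by rewrite mxE (nth_map j) ?size_enum_ord // nth_ord_enum /= coefZ coefD mulrC.
Qed.

Theorem theorem4p2 (R : realFieldType) (m n : nat) (lt_mn : (m < n)%N)
    (s : 'I_m.+1 -> 'I_n.+1) (s_inj : injective s) :
  let Es : 'M[R]_m.+1 := rowsub s (elevation R m n) in
  let A : 'M[R]_m.+1 := invmx Es in
  let D : 'rV[{poly R}]_m.+1 := bernstein_row R m *m map_mx polyC A in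
  [/\ Es \in unitmx,
      basis_of_degree_le m D,
      forall i j : 'I_m.+1, dual_bernstein n (s i) (D 0 j) = (i == j)%:R
    & forall t : R, \sum_(i < m.+1) (D 0 i).[t] = 1].
Proof.
move=> Es A D; have le_mn := ltnW lt_mn.
set Ms := rowsub s (dual_monomial R m n).
have Ms_unit : Ms \in unitmx by exact: dual_monomial_unit.
have EsT : Es *m bernstein_coord R m = Ms.
  by rewrite /Ms -(elevation_coord R le_mn) mul_rowsub_mx.
have Es_unit : Es \in unitmx by move: Ms_unit; rewrite -EsT unitmx_mul => /andP[].
set N := invmx Ms.
have DE : D = monomial_row R m *m map_mx polyC N.
  have AE : A = bernstein_coord R m *m N.
    by rewrite -[RHS](mulKmx Es_unit) [Es *m _]mulmxA EsT mulmxV // mulmx1.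
  by rewrite /D AE map_mxM mulmxA bernstein_row_coord.
split=> //.
- by rewrite DE; apply: monomial_row_basis; rewrite unitmx_inv.
- move=> i j; rewrite DE monomial_rowE (@dual_bernstein_coef _ m) ?size_poly //.
  (* Row [i] of [Ms] is the functional on monomials, column [j] of [N] the coefficients of
     [D 0 j]. *)
  have <- : (Ms *m N) i j = (i == j)%:R by rewrite mulmxV // mxE.
  rewrite mxE; apply: eq_bigr => l _.
  by rewrite !mxE coef_poly ltn_ord inord_val.
- move=> t; pose e0 : 'cV[R]_m.+1 := delta_mx 0 0.
  (* Column 0 of [Ms] is constantly 1, so [Ms] maps [e0] to the all-ones vector; the sum of [D] is
     then the monomial of degree 0. *)
  have Ne1 : N *m const_mx 1 = e0.
    rewrite -[RHS](mulKmx Ms_unit); congr (_ *m _).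
    apply/colP => i; rewrite -colE !mxE.
    by rewrite !bin0 divr1.
  rewrite -horner_sum -[RHS](hornerC 1 t); congr (_.[t]).
  have -> : \sum_i D 0 i = (D *m map_mx polyC (const_mx 1)) 0 (0 : 'I_1).
    by rewrite mxE; apply: eq_bigr => i _; rewrite !mxE mulr1.
  by rewrite DE -mulmxA -map_mxM Ne1 map_delta_mx -colE !mxE.
Qed.
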